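(* Let $(\mathfrak{g},J)$ be MaxN with $n=\dim_{\mathbb{C}}\mathfrak{g}$. Then there is a basis (coframe) $\{\omega^k\}_{k=1}^n$ of $\mathfrak{g}^{1,0}$ such that $$d\omega^k=\sum_{i<j<k}A_{ij}^k\,\omega^i\wedge\omega^j+\sum_{i,j<k}B_{ij}^k\,\omega^i\wedge\overline{\omega}^j,\qquad 1\le k\le n,$$ where, for each $2\le k\le n$, the coefficients $\{A_{i,k-1}^k\}_{i<k-1}$, $\{B_{k-1,j}^k\}_{j=1}^{k-1}$, $\{B_{i,k-1}^k\}_{i<k-1}$ are not all zero, and such that each $\omega^k$ ($1\le k\le n$) satisfies one of the following two conditions: (1) $d\omega^k+d\overline{\omega}^k=0$; (2) for all $a,b\in\mathbb{C}$, one has $a\,d\omega^k+b\,d\overline{\omega}^k\in\mathrm{span}_{\mathbb{C}}\{d\omega^{k-1},d\overline{\omega}^{k-1},\dots,d\omega^1,d\overline{\omega}^1\}$ if and only if $a=b=0$.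
   Context: Lie algebras are real, of finite positive dimension. A complex structure on $\mathfrak{g}$ is a linear endomorphism $J:\mathfrak{g}\to\mathfrak{g}$ with $J^2=-1$ and $[JX,JY]=J[JX,Y]+J[X,JY]+[X,Y]$ for all $X,Y\in\mathfrak{g}$; $\dim_{\mathbb{C}}\mathfrak{g}=\frac12\dim_{\mathbb{R}}\mathfrak{g}$. $\mathfrak{g}^{1,0}$ is the $\sqrt{-1}$-eigenspace of $J$ acting on $\mathfrak{g}^*_{\mathbb{C}}=\mathfrak{g}^*\otimes_{\mathbb{R}}\mathbb{C}$ by $(J\alpha)(X)=\alpha(JX)$. $d$ is the Chevalley–Eilenberg differential, $d\alpha(X,Y)=-\alpha([X,Y])$, extended complex-linearly. Put $\mathfrak{a}_0=0$ and $\mathfrak{a}_k=\{X\in\mathfrak{g} : [X,\mathfrak{g}]\subseteq\mathfrak{a}_{k-1},\ [JX,\mathfrak{g}]\subseteq\mathfrak{a}_{k-1}\}$ for $k\ge1$. $J$ is nilpotent if $\mathfrak{a}_t=\mathfrak{g}$ for some $t$, and then $\nu(J)$ is the smallest such $t$. $(\mathfrak{g},J)$ is MaxN (maximal nilpotent) if $\mathfrak{g}$ is nilpotent and $J$ is a nilpotent complex structure with $\nu(J)=\dim_{\mathbb{C}}\mathfrak{g}$. *)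

(* Defs.v *)
From HB Require Import structures.
From mathcomp Require Import all_boot all_order all_algebra.
From mathcomp Require Import sesquilinear.
From mathcomp Require Import complex.
From mathcomp Require Import boolp classical_sets functions reals.
Set Implicit Arguments.
Unset Strict Implicit.
Unset Printing Implicit Defensive.
Import GRing.Theory.
Local Open Scope ring_scope.
Local Open Scope complex_scope.

Section LieAlgebra.
Variables (R : realType) (V : vectType R).

Record lie_bracket (br : {bilinear V -> V -> V}) : Prop := LieBracket {
  bracket_alternating : forall X, br X X = 0;
  bracket_jacobi : forall X Y Z,
    br X (br Y Z) + br Y (br Z X) + br Z (br X Y) = 0 }.

Variables (br : {bilinear V -> V -> V}) (J : 'End(V)).

(* The span of all brackets [X, Y] with X in U and Y in W; by bilinearity it
   is spanned by the brackets of basis vectors (cf. prodv in falgebra). *)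
Definition bracketv (U W : {vspace V}) : {vspace V} :=
  <<allpairs br (vbasis U) (vbasis W)>>%VS.

Fixpoint lower_central (m : nat) : {vspace V} :=
  if m is m'.+1 then bracketv fullv (lower_central m') else fullv.

Definition lie_nilpotent : Prop := exists m, lower_central m = 0%VS.

Record complex_structure : Prop := ComplexStructure {
  complex_structure_sqr : forall X, J (J X) = - X;
  complex_structure_integrable : forall X Y,
    br (J X) (J Y) = J (br (J X) Y) + J (br X (J Y)) + br X Y }.

Definition dimC : nat := (\dim {:V})./2.

Fixpoint asc_series (k : nat) : set V :=
  if k is k'.+1 then
    [set X | (forall Y, asc_series k' (br X Y)) /\
             (forall Y, asc_series k' (br (J X) Y))]%classic
  else [set 0]%classic.

(* J is nilpotent and nu(J) = t *)
Definition nilpotency_step (t : nat) : Prop :=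
  asc_series t = setT /\ forall s, asc_series s = setT -> (t <= s)%N.

Record maxN : Prop := MaxN {
  maxN_lie : lie_bracket br;
  maxN_dim_gt0 : (0 < \dim {:V})%N;
  maxN_nilpotent : lie_nilpotent;
  maxN_complex : complex_structure;
  maxN_step : nilpotency_step dimC }.

(* The complexified dual of V is identified with the R-linear maps V -> C,
   and its elements, like complex-valued 2-forms, are handled as plain
   functions: V -> R[i] and V -> V -> R[i] carry the pointwise R[i]-module
   structure. *)
Definition real_linear (al : V -> R[i]) : Prop :=
  forall (r : R) (X Y : V), al (r *: X + Y) = r%:C * al X + al Y.

Definition form10 : set (V -> R[i]) :=
  [set al | real_linear al /\ forall X, al (J X) = 'i * al X]%classic.

Definition conj_form (al : V -> R[i]) : V -> R[i] := fun X => (al X)^*.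

Definition wedge (al be : V -> R[i]) : V -> V -> R[i] :=
  fun X Y => al X * be Y - al Y * be X.

Definition dform (al : V -> R[i]) : V -> V -> R[i] :=
  fun X Y => - al (br X Y).

Record is_coframe (n : nat) (w : 'I_n -> (V -> R[i])) : Prop := IsCoframe {
  coframe_form10 : forall k, form10 (w k);
  coframe_free : forall c : 'I_n -> R[i],
    \sum_k c k *: w k = 0 -> forall k, c k = 0;
  coframe_span : forall al, form10 al ->
    exists c : 'I_n -> R[i], al = \sum_k c k *: w k }.

(* The complex span of the 2-forms d w_j and d (conj w_j), for j < k. *)
Definition dspan_lt (n : nat) (w : 'I_n -> (V -> R[i])) (k : 'I_n) :
    set (V -> V -> R[i]) :=
  [set eta | exists c c' : 'I_n -> R[i],
    eta = \sum_(j < n | (j < k)%N)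
      (c j *: dform (w j) + c' j *: dform (conj_form (w j)))]%classic.

End LieAlgebra.

(* Main.v *)
Require Import Defs.
From mathcomp Require Import all_boot all_order all_algebra.
From mathcomp Require Import sesquilinear.
From mathcomp Require Import complex.
From mathcomp Require Import boolp classical_sets functions reals.
From mathcomp Require Import ring zify.

(** The terms a_0 < a_1 < ... < a_n of the ascending series are J-stable real
    subspaces.  By minimality of the step the inclusions are strict, and since
    there are n of them in complex dimension n, each successive quotient is a
    complex line.  Picking e_k in a_(n-k) but not in a_(n-k-1), for k < n, thus
    gives a complex basis of (g, J) adapted to this flag
    ([flag_basis_exists], [complex_free_dual]).

    Let W_k be the space of (1,0)-forms that vanish on a_(n-k).  A family w with
    w_k in W_(k+1) and w_k(e_k) <> 0 pairs triangularly with e, hence is a coframe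
    with a dual frame f ([triangular_dual_frame]), and any such choice satisfies
    the first two conclusions.  Indeed [a_(n-k), g] lies in a_(n-k-1), where w_k
    vanishes, so that d w_k involves only the w_i and conj w_j with i, j < k;
    integrability of J excludes a (0,2)-part ([adapted_structure_equation]).  If
    d w_(m+1) did not involve w_m or conj w_m, then the brackets [f_m, X] and
    [J f_m, X] would drop by two steps of the flag instead of one, which puts
    f_m in a_(n-m-1), contrary to w_m(f_m) = 1 ([adapted_coef_neq0]).

    The remaining freedom w_k -> z w_k + be, with z <> 0 and be in W_k, gives the
    alternative.  The span S_k of the d al and d (conj al), for al in W_k,
    depends only on the flag and is stable under conjugation.  If some nontrivial
    combination a d w_k + b d (conj w_k) lies in S_k, adding to a complex multiple
    of it the conjugate yields z <> 0 such that the real form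
    z d w_k + conj (z d w_k) lies in S_k; being real, it is d be + conj (d be) for
    some be in W_k, so that z w_k - be satisfies the first condition.  Otherwise
    w_k satisfies the second ([differential_dichotomy]).  Because S_k does not
    depend on the chosen coframe, the corrections are made for each k
    independently. *)

Set Implicit Arguments.
Unset Strict Implicit.
Unset Printing Implicit Defensive.
Import GRing.Theory Num.Theory.
Local Open Scope ring_scope.
Local Open Scope complex_scope.
(* In ring_scope the same notation would otherwise denote the conjugation of
   numeric closed fields, which is only convertible to conjc. *)
Local Notation "x ^*" := (conjc x) : ring_scope.

(** * Real-linear forms with complex values *)

Section RealLinearForms.
Variables (R : realType) (V : vectType R).
Implicit Types (al : V -> R[i]) (X Y : V).

Lemma real_linearD al X Y : real_linear al -> al (X + Y) = al X + al Y.
Proof. by move=> h; rewrite -[X in X + Y]scale1r h rmorph1 mul1r. Qed.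

Lemma real_linear0 al : real_linear al -> al 0 = 0.
Proof. by move=> h; apply: (addrI (al 0)); rewrite -real_linearD // !addr0. Qed.

Lemma real_linearZ al r X : real_linear al -> al (r *: X) = r%:C * al X.
Proof. by move=> h; rewrite -[_ *: X]addr0 h real_linear0 // addr0. Qed.

Lemma real_linearN al X : real_linear al -> al (- X) = - al X.
Proof. by move=> h; rewrite -scaleN1r real_linearZ // rmorphN1 mulN1r. Qed.

Lemma real_linear_sum al I (r : seq I) (P : pred I) (F : I -> V) :
  real_linear al -> al (\sum_(i <- r | P i) F i) = \sum_(i <- r | P i) al (F i).
Proof.
move=> h; apply: (big_morph al) => [X Y|]; first exact: real_linearD.
exact: real_linear0.
Qed.

End RealLinearForms.

(** * Frames and coframes of a vector space with complex structure *)

Section ComplexStructure.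
Variables (R : realType) (V : vectType R) (J : 'End(V)).
Hypothesis JJ : forall X, J (J X) = - X.
Implicit Types (al : V -> R[i]) (X Y : V) (z : R[i]).

(** The complex vector space structure of V in which J is multiplication by i.
    It is kept as an operation, V being already a real vector space. *)
Definition cscale z X : V := complex.Re z *: X + complex.Im z *: J X.

Lemma cscale0l X : cscale 0 X = 0.
Proof. by rewrite /cscale /= !scale0r addr0. Qed.

Lemma cscale0r z : cscale z 0 = 0.
Proof. by rewrite /cscale !linear0 addr0. Qed.

Lemma cscale1 X : cscale 1 X = X.
Proof. by rewrite /cscale /= scale1r scale0r addr0. Qed.

Lemma cscaleDl z z' X : cscale (z + z') X = cscale z X + cscale z' X.
Proof. by case: z z' => [a b] [c d]; rewrite /cscale /= !scalerDl addrACA. Qed.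

Lemma cscaleDr z X Y : cscale z (X + Y) = cscale z X + cscale z Y.
Proof. by rewrite /cscale !linearD addrACA. Qed.

Lemma cscaleNl z X : cscale (- z) X = - cscale z X.
Proof. by case: z => a b; rewrite /cscale /= !scaleNr opprD. Qed.

Lemma cscaleM z z' X : cscale z (cscale z' X) = cscale (z * z') X.
Proof.
case: z z' => [a b] [c d]; rewrite /cscale /=.
rewrite [J (_ + _)]linearD /= ![J (_ *: _)]linearZZ /= JJ !scalerDr !scalerA scalerN.
rewrite scalerBl scalerDl -!addrA; congr (_ + _).
by rewrite addrA [RHS]addrC.
Qed.

Lemma cscaleZ r z X : r *: cscale z X = cscale (r%:C * z) X.
Proof. by rewrite -cscaleM {2}/cscale /= scale0r addr0. Qed.

Lemma cscale_sumr z I (r : seq I) (P : pred I) (F : I -> V) :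
  cscale z (\sum_(i <- r | P i) F i) = \sum_(i <- r | P i) cscale z (F i).
Proof. apply: (big_morph (cscale z)) => [X Y|]; [exact: cscaleDr|exact: cscale0r]. Qed.

Lemma cscale_suml X I (r : seq I) (P : pred I) (F : I -> R[i]) :
  cscale (\sum_(i <- r | P i) F i) X = \sum_(i <- r | P i) cscale (F i) X.
Proof.
apply: (big_morph (fun z => cscale z X)) => [z z'|]; [exact: cscaleDl|exact: cscale0l].
Qed.

Lemma J_cscale z X : J (cscale z X) = cscale (0 +i* 1 * z) X.
Proof. by rewrite -cscaleM {2}/cscale /= scale0r add0r scale1r. Qed.

Lemma form10_cscale al z X : form10 J al -> al (cscale z X) = z * al X.
Proof.
move=> [lin alJ]; rewrite /cscale real_linearD // !real_linearZ // alJ mulrA.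
by rewrite -mulrDl; congr (_ * _); rewrite [RHS]complexE complexiE mulrC [X in _ + X]mulrC.
Qed.

Definition complex_free m (u : 'I_m -> V) :=
  forall c : 'I_m -> R[i], \sum_k cscale (c k) (u k) = 0 -> forall k, c k = 0.

(** The vectors u_k together with the J u_k are linearly independent over R. *)
Lemma complex_free_leq_dim m (u : 'I_m -> V) :
  complex_free u -> (m.*2 <= \dim {:V})%N.
Proof.
move=> free_u.
pose s := [tuple of [tuple u k | k < m] ++ [tuple J (u k) | k < m]].
have: free s.
  apply/freeP => k; rewrite big_split_ord /=.
  under eq_bigr => i _ do
    rewrite nth_cat size_map -cardE card_ord ltn_ord (nth_map i) ?size_enum_ord // nth_ord_enum.
  under [X in _ + X]eq_bigr => i _ do
    rewrite nth_cat size_map -cardE card_ord ltnNge leq_addr /= addKn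
            (nth_map i) ?size_enum_ord // nth_ord_enum.
  rewrite -big_split /= => /(free_u (fun i => k (lshift m i) +i* k (rshift m i))) k0 i.
  by case: (split_ordP i) => j ->; have [] := k0 j.
rewrite /free size_tuple => /eqP dim_s.
by rewrite -addnn -dim_s dimvS ?subvf.
Qed.

(** A vector outside the complex span would extend e to a complex-free family of
    n + 1 vectors, which needs real dimension 2n + 2.  Asking only for less than
    2n + 2 covers dimension 2n + 1 as well, so that the parity of the dimension
    never has to be established. *)
Lemma cscale_spanning n (e : 'I_n -> V) X :
  (\dim {:V} < n.*2.+2)%N -> complex_free e ->
  exists c : 'I_n -> R[i], X = \sum_k cscale (c k) (e k).
Proof.
move=> dimV free_e; apply: contrapT => not_span.
pose u (k : 'I_n.+1) := if unlift ord0 k is Some j then e j else X.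
suff /complex_free_leq_dim : complex_free u by rewrite doubleS leqNgt dimV.
move=> c; rewrite big_ord_recl /u unlift_none.
under eq_bigr => i _ do rewrite liftK.
move=> cX; have c0 : c ord0 = 0.
  apply: contrapT => /eqP c0; apply: not_span.
  exists (fun k => - ((c ord0)^-1 * c (lift ord0 k))).
  have := congr1 (cscale (c ord0)^-1) cX.
  rewrite cscale0r cscaleDr cscaleM mulVf // cscale1 cscale_sumr => /eqP.
  rewrite addr_eq0 => /eqP ->; rewrite -sumrN.
  by apply: eq_bigr => i _; rewrite cscaleNl cscaleM.
move: cX; rewrite c0 cscale0l add0r => /free_e ce k.
by case: (unliftP ord0 k) => [j|] ->.
Qed.

Record dual_frame n (w : 'I_n -> V -> R[i]) (f : 'I_n -> V) : Prop := DualFrame {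
  dual_form10 : forall k, form10 J (w k);
  dual_pairing : forall j k, w j (f k) = (j == k)%:R;
  dual_expand : forall X, X = \sum_k cscale (w k X) (f k) }.

Lemma complex_free_dual n (e : 'I_n -> V) :
  (\dim {:V} < n.*2.+2)%N -> complex_free e ->
  exists th, dual_frame th e.
Proof.
move=> dimV free_e.
have [th thE] := choice (fun X => cscale_spanning X dimV free_e).
have uniq_coord X (c : 'I_n -> R[i]) k : X = \sum_k cscale (c k) (e k) -> th X k = c k.
  move=> XE; apply/eqP; rewrite -subr_eq0; apply/eqP.
  apply: (free_e (fun k => th X k - c k)).
  under eq_bigr do rewrite cscaleDl cscaleNl.
  by rewrite sumrB -thE -XE subrr.
exists (fun k X => th X k); split=> [k|j k|X]; last exact: thE.
- split=> [r X Y|X].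
    apply: (uniq_coord _ (fun j => r%:C * th X j + th Y j)).
    under eq_bigr do rewrite cscaleDl -cscaleZ.
    by rewrite big_split /= -scaler_sumr -!thE.
  apply: (uniq_coord _ (fun j => 'i * th X j)).
  rewrite {1}(thE X) linear_sum /=; apply: eq_bigr => j _.
  by rewrite J_cscale complexiE.
- apply: (uniq_coord _ (fun j => (j == k)%:R)).
  rewrite (bigD1 k) //= eqxx cscale1 big1 ?addr0 // => i /negPf ->.
  by rewrite cscale0l.
Qed.

Lemma dual_frame_coframe n (w : 'I_n -> V -> R[i]) f :
  dual_frame w f -> is_coframe J w.
Proof.
move=> [w10 wf Xf]; split=> [//|c cw k|al al10].
  have := congr1 (fun F : V -> R[i] => F (f k)) cw.
  rewrite fct_sumE /= (bigD1 k) //= !scalrfctE /= wf eqxx [_ *: _]mulr1.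
  rewrite big1 ?addr0 // => j /negPf jk.
  by rewrite !scalrfctE /= wf jk scaler0.
exists (fun k => al (f k)); apply/funext => X.
rewrite {1}(Xf X) real_linear_sum; last by case: al10.
rewrite fct_sumE; apply: eq_bigr => k _.
by rewrite form10_cscale // mulrC.
Qed.

(** The matrix of the pairings w_k(e_j) is triangular with nonzero diagonal, and
    its inverse expresses the frame dual to w in terms of e. *)
Lemma triangular_dual_frame n (w : 'I_n -> V -> R[i]) (th : 'I_n -> V -> R[i]) e :
  dual_frame th e -> (forall k, form10 J (w k)) ->
  (forall k j : 'I_n, (k < j)%N -> w k (e j) = 0) ->
  (forall k, w k (e k) != 0) ->
  exists f, dual_frame w f.
Proof.
move=> [th10 the Xe] w10 w_tri w_diag.
pose M : 'M[R[i]]_n := \matrix_(k, j) w k (e j).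
have M_unit : M \in unitmx.
  rewrite unitmxE det_trig; last by apply/is_trig_mxP => k j kj; rewrite mxE w_tri.
  by rewrite unitfE; apply/prodf_neq0 => k _; rewrite mxE.
have lin k : real_linear (w k) by case: (w10 k).
have wE k X : w k X = \sum_j M k j * th j X.
  rewrite {1}(Xe X) real_linear_sum //; apply: eq_bigr => j _.
  by rewrite form10_cscale // mulrC mxE.
pose f k := \sum_j cscale (invmx M j k) (e j).
exists f; split=> // [j k|X].
  rewrite /f real_linear_sum //.
  transitivity ((M *m invmx M) j k); last by rewrite mulmxV // mxE.
  by rewrite mxE; apply: eq_bigr => l _; rewrite form10_cscale // !mxE mulrC.
rewrite {1}(Xe X) /f.
under [RHS]eq_bigr do rewrite cscale_sumr.
rewrite exchange_big /=; apply: eq_bigr => j _.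
under eq_bigr do rewrite cscaleM.
rewrite -cscale_suml; congr cscale.
pose v := \col_i th i X.
have -> : th j X = (invmx M *m (M *m v)) j 0 by rewrite mulKmx // mxE.
rewrite mxE; apply: eq_bigr => k _; rewrite mulrC wE; congr (_ * _).
by rewrite mxE; apply: eq_bigr => i _; rewrite [v _ _]mxE.
Qed.

End ComplexStructure.

(** * Differentials and conjugation *)

Section TwoForms.
Variables (R : realType) (V : vectType R) (br : {bilinear V -> V -> V}).
Implicit Types (al be : V -> R[i]) (c : R[i]).

Lemma dformD al be : dform br (al + be) = dform br al + dform br be.
Proof. by apply/funext => X; apply/funext => Y; rewrite /dform !addrfctE opprD. Qed.

Lemma dformZ c al : dform br (c *: al) = c *: dform br al.
Proof. by apply/funext => X; apply/funext => Y; rewrite /dform !scalrfctE scalerN. Qed.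

Definition conj_form2 (eta : V -> V -> R[i]) : V -> V -> R[i] :=
  fun X Y => (eta X Y)^*.

Lemma conj_form2D : {morph conj_form2 : eta zeta / eta + zeta}.
Proof.
by move=> eta zeta; apply/funext => X; apply/funext => Y; rewrite /conj_form2 !addrfctE rmorphD.
Qed.

Lemma conj_form2Z c eta : conj_form2 (c *: eta) = c^* *: conj_form2 eta.
Proof. by apply/funext => X; apply/funext => Y; rewrite /conj_form2 !scalrfctE rmorphM. Qed.

Lemma conj_form2K : involutive conj_form2.
Proof. by move=> eta; apply/funext => X; apply/funext => Y; exact: conjcK. Qed.

(** Averaging L = A + conj B with its conjugate makes the two parts conjugate to
    each other. *)
Lemma real_average L A B : conj_form2 L = L -> L = A + conj_form2 B ->
  L = 2^-1 *: A + 2^-1 *: B + conj_form2 (2^-1 *: A + 2^-1 *: B).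
Proof.
move=> L_real LE.
have LE' : L = B + conj_form2 A.
  by rewrite -L_real LE conj_form2D conj_form2K addrC.
have half_conj : (2^-1 : R[i])^* = 2^-1 by rewrite conjc_inv conjc_nat.
have half2 : 2^-1 + 2^-1 = 1 :> R[i] by field.
rewrite conj_form2D !conj_form2Z half_conj.
rewrite -[LHS]scale1r -[in LHS]half2 scalerDl {1}LE LE' !scalerDr addrACA.
by congr (_ + _); rewrite addrC.
Qed.

Lemma dform_conj al : dform br (conj_form al) = conj_form2 (dform br al).
Proof. by apply/funext => X; apply/funext => Y; rewrite /dform /conj_form2 rmorphN. Qed.

End TwoForms.

(** * Correcting a form so that its differential is imaginary or independent *)

Section Dichotomy.
Variables (R : realType) (V : vectType R) (br : {bilinear V -> V -> V}).
Variables (J : 'End(V)) (K : set V).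
Implicit Types (al be : V -> R[i]) (c : R[i]).

Definition annihilator10 : set (V -> R[i]) :=
  [set al | form10 J al /\ forall X, K X -> al X = 0]%classic.

Lemma form10_comb c d al be :
  form10 J al -> form10 J be -> form10 J (c *: al + d *: be).
Proof.
move=> [al_lin alJ] [be_lin beJ]; split=> [r X Y|X]; rewrite !addrfctE !scalrfctE.
  by rewrite al_lin be_lin /GRing.scale /=; ring.
by rewrite alJ beJ /GRing.scale /=; ring.
Qed.

Lemma annihilator10_comb c d al be :
  annihilator10 al -> annihilator10 be -> annihilator10 (c *: al + d *: be).
Proof.
move=> [al10 alK] [be10 beK]; split=> [|X KX]; first exact: form10_comb.
by rewrite !addrfctE !scalrfctE alK // beK // !scaler0 addr0.
Qed.

Lemma annihilator10_0 : annihilator10 0.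
Proof. by split=> // ; split=> [r X Y|X]; rewrite /= ?mulr0 ?addr0. Qed.

(** The span of the differentials of the annihilating (1,0)-forms and of their
    conjugates; conjugates are taken of the 2-forms, as d is real, which makes the
    stability under conjugation immediate. *)
Definition dspan : set (V -> V -> R[i]) :=
  [set eta | exists al be, [/\ annihilator10 al, annihilator10 be
    & eta = dform br al + conj_form2 (dform br be)]]%classic.

Lemma dspan_comb c d eta zeta :
  dspan eta -> dspan zeta -> dspan (c *: eta + d *: zeta).
Proof.
move=> [al [be [al_ann be_ann ->]]] [al' [be' [al'_ann be'_ann ->]]].
exists (c *: al + d *: al'), (c^* *: be + d^* *: be').
split; try exact: annihilator10_comb.
by rewrite !dformD !dformZ conj_form2D !conj_form2Z !conjcK !scalerDr addrACA.
Qed.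

Lemma dspan_conj eta : dspan eta -> dspan (conj_form2 eta).
Proof.
move=> [al [be [al_ann be_ann ->]]]; exists be, al; split=> //.
by rewrite conj_form2D conj_form2K addrC.
Qed.

Lemma real_dspan_witness z eta :
  dspan (z *: eta + z^* *: conj_form2 eta) ->
  exists2 be, annihilator10 be
    & z *: eta + z^* *: conj_form2 eta = dform br be + conj_form2 (dform br be).
Proof.
move=> [al [be [al_ann be_ann E]]].
exists (2^-1 *: al + 2^-1 *: be).
  exact: annihilator10_comb.
rewrite dformD !dformZ; apply: real_average E.
by rewrite conj_form2D !conj_form2Z conj_form2K conjcK addrC.
Qed.

(** A relation a eta + b (conj eta) in the span S, where eta = d al0, can be
    multiplied by any l and added to its conjugate, which gives a relation
    z eta + conj (z eta) in S with z = l a + conj (l b).  Taking l = 1 and l = i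
    gives two values of z that vanish together only for a = b = 0. *)
Lemma differential_dichotomy al0 :
  form10 J al0 ->
  exists (z : R[i]) (be : V -> R[i]), [/\ z != 0, annihilator10 be
    & let w := z *: al0 + be in
      dform br w + dform br (conj_form w) = 0 \/
      forall a b, dspan (a *: dform br w + b *: dform br (conj_form w)) ->
        a = 0 /\ b = 0].
Proof.
move=> al010; set eta := dform br al0.
have [[a [b [ab0 ab]]]|indep] :=
    pselect (exists a b, ~ (a = 0 /\ b = 0) /\ dspan (a *: eta + b *: conj_form2 eta)).
  have real_comb l : dspan ((l * a + (l * b)^*) *: eta
      + (l * a + (l * b)^*)^* *: conj_form2 eta).
    have := dspan_comb l l^* ab (dspan_conj ab).
    rewrite conj_form2D !conj_form2Z conj_form2K !scalerDr !scalerA.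
    by rewrite [X in _ + X]addrC addrACA -!scalerDl rmorphD !rmorphM /= !conjcK
               [_ * b + _]addrC.
  have [z z0 z_real] : exists2 z : R[i], z != 0
      & dspan (z *: eta + z^* *: conj_form2 eta).
    have [sum0|sum_neq0] := eqVneq (a + b^*) 0; last first.
      by exists (1 * a + (1 * b)^*); [rewrite !mul1r | exact: real_comb].
    (* When a = - conj b, the multiplier i gives z = 2 i a. *)
    exists (0 +i* 1 * a + (0 +i* 1 * b)^*); last exact: real_comb.
    have -> : (0 +i* 1 * b)^* = - (0 +i* 1 * b^*).
      by rewrite rmorphM /= -[RHS]mulNr; congr (_ * _); congr Complex; rewrite /= ?oppr0.
    rewrite -mulrBr mulf_neq0 //; first by rewrite eq_complex /= eqxx oner_eq0.
    rewrite subr_eq0; apply/eqP => abE; apply: ab0.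
    move/eqP: sum0; rewrite abE -mulr2n mulrn_eq0 /= => /eqP b0.
    by split; [|apply/eqP; rewrite -conjc_eq0]; rewrite ?abE b0.
  have [be be_ann E] := real_dspan_witness z_real.
  exists z, (-1 *: be); split=> //.
    by rewrite -[_ *: be]addr0 -(scale0r be); exact: annihilator10_comb.
  left; rewrite /= dform_conj dformD dformZ conj_form2D conj_form2Z -/eta addrACA E.
  by rewrite dformZ conj_form2Z rmorphN1 -scalerDr scaleN1r subrr.
exists 1, 0; split=> //=; first by rewrite oner_eq0.
  exact: annihilator10_0.
right=> a b; rewrite scale1r addr0 dform_conj => ab.
by apply: contrapT => ab0; apply: indep; exists a, b.
Qed.

End Dichotomy.

(** * Components of a differential by type *)

Section PolarDecomposition.
Variables (R : realType) (V : vectType R) (br : {bilinear V -> V -> V}).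
Variables (J : 'End(V)).
Hypotheses (br_lie : lie_bracket br) (J_cplx : complex_structure br J).

Lemma bracketC X Y : br X Y = - br Y X.
Proof.
have alt := bracket_alternating br_lie.
apply/eqP; rewrite -addr_eq0; have := alt (X + Y).
by rewrite linearDl !linearDr /= !alt add0r addr0 => ->.
Qed.

Lemma bracketNl X Y : br (- X) Y = - br X Y.
Proof. by rewrite linearNl. Qed.

Lemma bracket0l Y : br 0 Y = 0.
Proof. by rewrite linear0l. Qed.

Lemma bracketPl r X Y Z : br (r *: X + Y) Z = r *: br X Z + br Y Z.
Proof. by rewrite linearPl. Qed.

Lemma bracketPr r X Y Z : br Z (r *: X + Y) = r *: br Z X + br Z Y.
Proof. by rewrite linearPr. Qed.

Lemma dform_real_linearl (al : V -> R[i]) Y :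
  real_linear al -> real_linear (fun X => dform br al X Y).
Proof. by move=> al_lin r X X'; rewrite /dform bracketPl al_lin opprD mulrN. Qed.

Lemma dform_real_linearr (al : V -> R[i]) X :
  real_linear al -> real_linear (dform br al X).
Proof. by move=> al_lin r Y Y'; rewrite /dform bracketPr al_lin opprD mulrN. Qed.

Lemma dform_antisym (al : V -> R[i]) X Y :
  real_linear al -> dform br al X Y = - dform br al Y X.
Proof. by move=> al_lin; rewrite /dform bracketC real_linearN. Qed.

(** Integrability of J says exactly that d al has no (0,2)-part when al has
    type (1,0); here this is expressed on real vectors. *)
Lemma dform_JJ (al : V -> R[i]) X Y : form10 J al ->
  dform br al (J X) (J Y) =
  'i * dform br al (J X) Y + 'i * dform br al X (J Y) + dform br al X Y.
Proof.
move=> [al_lin alJ]; rewrite /dform (complex_structure_integrable J_cplx).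
by rewrite !real_linearD // !alJ !opprD !mulrN.
Qed.

(** The values of d al on the (1,0)-vectors of u and v, that is on
    (u - i J u) / 2 and (v - i J v) / 2, simplified by means of [dform_JJ]. *)
Definition part20 (al : V -> R[i]) u v :=
  - ('i / 2) * (dform br al (J u) v + dform br al u (J v)).
(** The value of d al on the (1,0)-vector of u and the (0,1)-vector of v,
    simplified in the same way. *)
Definition part11 (al : V -> R[i]) u v :=
  2^-1 * (dform br al u v + 'i * dform br al u (J v)).

Lemma part20_antisym al u v : real_linear al -> part20 al u v = - part20 al v u.
Proof.
move=> al_lin; rewrite /part20 dform_antisym // [dform br al u (J v)]dform_antisym //.
by ring.
Qed.

(** The scalar identity behind [dform_cscale]: a, b and c stand for the values at
    (u, v), (J u, v) and (u, J v), and the value at (J u, J v) is determined by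
    them. *)
Lemma polar_identity (x y a b c : R[i]) :
  (complex.Re x)%:C * ((complex.Re y)%:C * a + (complex.Im y)%:C * c) +
  (complex.Im x)%:C * ((complex.Re y)%:C * b + (complex.Im y)%:C * ('i * b + 'i * c + a)) =
  x * y * (- ('i / 2) * (b + c)) + x * y^* * (2^-1 * (a + 'i * c))
    + x^* * y * (2^-1 * (a + 'i * b)).
Proof.
have decomp z : exists p q : R[i], [/\ z = p + 'i * q, z^* = p - 'i * q,
    (complex.Re z)%:C = p & (complex.Im z)%:C = q].
  exists (complex.Re z)%:C, (complex.Im z)%:C; split=> //.
    by rewrite [LHS]complexE complexiE.
  rewrite -complexiE; case: z => z1 z2; apply/eqP.
  by rewrite eq_complex /= !(mul0r, mulr0, mul1r, subr0, addr0, add0r, oppr0) ?eqxx.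
have [x1 [x2 [xE xcE -> ->]]] := decomp x.
have [y1 [y2 [yE ycE -> ->]]] := decomp y.
rewrite xcE ycE {1}xE {1}yE xE yE.
have II : 'i * 'i = -1 :> R[i] by rewrite -expr2 sqrCi.
move: II; set I : R[i] := 'i%R; clearbody I => II.
(* The two sides agree up to this explicit multiple of i^2 + 1. *)
transitivity (x1 * (y1 * a + y2 * c) + x2 * (y1 * b + y2 * (I * b + I * c + a))
  + (I * I + 1) * - (x2 * y2 * a + (x1 * y2 + I * (x2 * y2)) * c
     + (x2 * y1 + I * (x2 * y2)) * b)).
  by rewrite II addNr mul0r addr0.
by field.
Qed.

Lemma dform_cscale al x y u v : form10 J al ->
  dform br al (cscale J x u) (cscale J y v) =
  x * y * part20 al u v + x * y^* * part11 al u v - x^* * y * part11 al v u.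
Proof.
move=> al10; have al_lin : real_linear al by case: al10.
have dl := dform_real_linearl _ al_lin; have dr := dform_real_linearr _ al_lin.
rewrite {1}/cscale (real_linearD _ _ (dl _)) !(real_linearZ _ _ (dl _)).
rewrite /cscale !(real_linearD _ _ (dr _)) !(real_linearZ _ _ (dr _)).
rewrite dform_JJ // /part20 /part11.
rewrite [dform br al v u]dform_antisym // [dform br al v (J u)]dform_antisym //.
by rewrite polar_identity; ring.
Qed.

End PolarDecomposition.

(** * The ascending series as a complete flag *)

Section AscendingSeries.
Variables (R : realType) (V : vectType R) (br : {bilinear V -> V -> V}).
Variables (J : 'End(V)).
Hypothesis J_cplx : complex_structure br J.
Local Notation a_ := (asc_series br J).

Let JJ := complex_structure_sqr J_cplx.

Lemma asc_comb m r X Y : a_ m X -> a_ m Y -> a_ m (r *: X + Y).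
Proof.
elim: m r X Y => [|m IH] r X Y /=; first by move=> -> ->; rewrite scaler0 addr0.
move=> [X1 X2] [Y1 Y2]; split=> Z; first by rewrite bracketPl; apply: IH.
by rewrite linearP bracketPl; apply: IH.
Qed.

Lemma asc0 m : a_ m 0.
Proof. by elim: m => //= m IH; split=> Z; rewrite ?linear0 bracket0l. Qed.

Lemma ascD m X Y : a_ m X -> a_ m Y -> a_ m (X + Y).
Proof. by rewrite -{2}[X]scale1r; apply: asc_comb. Qed.

Lemma ascZ m r X : a_ m X -> a_ m (r *: X).
Proof. by move=> mX; rewrite -[_ *: _]addr0; apply: asc_comb => //; apply: asc0. Qed.

Lemma ascN m X : a_ m X -> a_ m (- X).
Proof. by rewrite -scaleN1r; apply: ascZ. Qed.

Lemma asc_J m X : a_ m X -> a_ m (J X).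
Proof.
case: m => [|m] /=; first by move=> ->; rewrite linear0.
by move=> [X1 X2]; split=> // Z; rewrite JJ bracketNl; apply: ascN.
Qed.

Lemma asc_cscale m z X : a_ m X -> a_ m (cscale J z X).
Proof. by move=> mX; apply: asc_comb => //; apply/ascZ/asc_J. Qed.

Lemma asc_sum m I (r : seq I) (P : pred I) (F : I -> V) :
  (forall i, P i -> a_ m (F i)) -> a_ m (\sum_(i <- r | P i) F i).
Proof. by move=> mF; apply: big_ind => //; [apply: asc0|apply: ascD]. Qed.

Lemma ascS m X : a_ m X -> a_ m.+1 X.
Proof.
elim: m X => [|m IH] X; last by move=> [X1 X2]; split=> Z; [exact/IH/X1|exact/IH/X2].
by move=> /= ->; split=> Z; rewrite ?linear0 bracket0l.
Qed.

Lemma asc_leq m m' X : (m <= m')%N -> a_ m X -> a_ m' X.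
Proof.
by move=> /subnK <- mX; elim: (m' - m)%N => // k IH; rewrite addSn; apply: ascS.
Qed.

(** If two consecutive terms agree, then the series is constant from there on, so
    it has reached the whole algebra before step t. *)
Lemma asc_strict t m : nilpotency_step br J t -> (m < t)%N ->
  exists X, a_ m.+1 X /\ ~ a_ m X.
Proof.
move=> [at_full t_min] mt; apply: contrapT => stable.
have stop X : a_ m.+1 X -> a_ m X.
  by move=> mX; apply: contrapT => mX'; apply: stable; exists X.
have stops k X : a_ (k + m)%N X -> a_ m X.
  elim: k X => // k IH X; rewrite addSn => -[X1 X2].
  by apply: stop; split=> Z; [exact/IH/X1|exact/IH/X2].
have : (t <= m)%N.
  apply: t_min; apply/seteqP; split=> // X _; apply: (stops (t - m)%N).
  by rewrite subnK 1?ltnW // at_full.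
by rewrite leqNgt mt.
Qed.

Definition flag_basis n (e : 'I_n -> V) :=
  forall k : 'I_n, a_ (n - k) (e k) /\ ~ a_ (n - k.+1) (e k).

Lemma flag_basis_exists n : nilpotency_step br J n -> exists e, @flag_basis n e.
Proof.
move=> step; suff /choice [e eP] : forall k : 'I_n, exists X,
    a_ (n - k) X /\ ~ a_ (n - k.+1) X by exists e.
move=> k; have [|X] := asc_strict step (m := (n - k.+1)%N).
  by have := ltn_ord k; lia.
by rewrite subnSK // => XP; exists X.
Qed.

Section FlagBasis.
Variables (n : nat) (e : 'I_n -> V).
Hypothesis flag_e : flag_basis e.

(** Solving for e_k in a combination that lies in a_m, and whose coefficients of
    index less than k vanish, would put e_k in a_(n-k-1).  For m = 0 this is
    freeness over the complex numbers. *)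
Lemma flag_coord0 m (c : 'I_n -> R[i]) :
  a_ m (\sum_k cscale J (c k) (e k)) -> forall k : 'I_n, (k < n - m)%N -> c k = 0.
Proof.
move=> mc k; have [d] := ubnP (val k); elim: d k => // d IH k kd km.
apply: contrapT => /eqP ck0; have [_] := flag_e k; apply.
rewrite -[e k](cscale1 J) -(mulVf ck0) -(cscaleM JJ); apply: asc_cscale.
have -> : cscale J (c k) (e k) =
    \sum_j cscale J (c j) (e j) - \sum_(j | j != k) cscale J (c j) (e j).
  by rewrite [X in X - _](bigD1 k) //= addrK.
apply: ascD; first by apply: asc_leq mc; have := ltn_ord k; lia.
apply/ascN/asc_sum => j jk; have [jltk|jgek] := ltnP j k.
  by rewrite IH //; [rewrite cscale0l; apply: asc0|apply: leq_trans jltk _|apply: ltn_trans km].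
apply: asc_cscale; have [je _] := flag_e j; apply: asc_leq je.
by move: jk; rewrite -val_eqE /=; lia.
Qed.

Lemma flag_complex_free : complex_free J e.
Proof.
move=> c c0 k; apply: (@flag_coord0 0); first by rewrite c0.
by rewrite subn0.
Qed.

End FlagBasis.
End AscendingSeries.

(** * Finite sums over pairs of indices *)

Section Sums.

Lemma sum_skew (K : pzRingType) n (T G : 'I_n -> 'I_n -> K) :
  (forall i, T i i = 0) -> (forall i j, T i j = - T j i) ->
  \sum_i \sum_j T i j * G i j =
  \sum_(j < n) \sum_(i < n | (i < j)%N) T i j * (G i j - G j i).
Proof.
move=> T0 T_skew; rewrite exchange_big /=.
transitivity (\sum_(j < n) (\sum_(i < n | (i < j)%N) T i j * G i j +
    \sum_(i < n | ~~ (i < j)%N) T i j * G i j)).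
  by apply: eq_bigr => j _; rewrite (bigID (fun i : 'I_n => (i < j)%N)).
under [RHS]eq_bigr => j _ do
  (under eq_bigr do rewrite mulrBr; rewrite sumrB).
rewrite big_split sumrB /=; congr (_ + _).
rewrite (exchange_big_dep predT) //= -sumrN; apply: eq_bigr => i _.
rewrite -sumrN big_mkcond [RHS]big_mkcond; apply: eq_bigr => j _ /=.
case: ltngtP => // [ji|/val_inj ->].
  by rewrite T_skew mulNr.
by rewrite T0 mul0r.
Qed.

Lemma sum_support (K : nmodType) n (k : nat) (F : 'I_n -> K) :
  (forall j : 'I_n, (k <= j)%N -> F j = 0) ->
  \sum_j F j = \sum_(j < n | (j < k)%N) F j.
Proof.
move=> F0; rewrite [RHS]big_mkcond; apply: eq_bigr => j _.
by case: ltnP => // /F0.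
Qed.

End Sums.

(** * Coframes adapted to the ascending series *)

Section AdaptedCoframe.
Variables (R : realType) (V : vectType R) (br : {bilinear V -> V -> V}).
Variables (J : 'End(V)) (n : nat) (e f : 'I_n -> V) (w th : 'I_n -> V -> R[i]).
Hypotheses (br_lie : lie_bracket br) (J_cplx : complex_structure br J).
Local Notation a_ := (asc_series br J).
Hypotheses (flag_e : flag_basis br J e) (th_dual : dual_frame J th e).
Hypothesis w_ann : forall k : 'I_n, annihilator10 J (a_ (n - k.+1)) (w k).
Hypothesis w_diag : forall k, w k (e k) != 0.
Hypothesis f_dual : dual_frame J w f.

Lemma adapted_triangular (k j : 'I_n) : (k < j)%N -> w k (e j) = 0.
Proof.
move=> kj; apply: (w_ann k).2; have [je _] := flag_e j.
by apply: asc_leq je => //; lia.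
Qed.

(** The common zeros of the first n - m forms do not exceed a_m: by triangularity
    the coordinates of X on e vanish one after the other, up to index n - m. *)
Lemma adapted_asc m X : (forall k : 'I_n, (k < n - m)%N -> w k X = 0) -> a_ m X.
Proof.
move=> wX; have coord0 : forall k : 'I_n, (k < n - m)%N -> th k X = 0.
  move=> k; have [d] := ubnP (val k); elim: d k => // d IH k kd km.
  have [w10 _] := w_ann k; have := wX k km.
  rewrite [X in w k X](dual_expand th_dual) real_linear_sum; last by case: w10.
  rewrite (bigD1 k) //= form10_cscale // big1 => [|j jk].
    by move/eqP; rewrite addr0 mulf_eq0 (negPf (w_diag k)) orbF => /eqP.
  rewrite form10_cscale //; have [jltk|jgek] := ltnP j k.
    by rewrite IH ?mul0r //; [apply: leq_trans jltk _|apply: ltn_trans km].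
  by rewrite adapted_triangular ?mulr0 //; move: jk; rewrite -val_eqE /=; lia.
rewrite (dual_expand th_dual X); apply: asc_sum => // k _.
have [km|mk] := ltnP k (n - m); first by rewrite coord0 // cscale0l; apply: asc0.
by apply: asc_cscale => //; have [ke _] := flag_e k; apply: asc_leq ke => //; lia.
Qed.

Lemma frame_asc (k j : 'I_n) : (k <= j)%N -> a_ (n - k) (f j).
Proof.
move=> kj; apply: adapted_asc => i ik; rewrite (dual_pairing f_dual).
by case: eqP => // ij; move: ik; rewrite ij; have := ltn_ord k; lia.
Qed.

Lemma dform_asc (k : 'I_n) X Y : a_ (n - k) X -> dform br (w k) X Y = 0.
Proof.
rewrite -subnSK // => -[XP _]; rewrite /dform (w_ann k).2 ?oppr0 //.
exact: XP.
Qed.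

Lemma part20_supportl (k i : 'I_n) Y : (k <= i)%N -> part20 br J (w k) (f i) Y = 0.
Proof.
move=> ki; have fi := frame_asc ki.
by rewrite /part20 !dform_asc ?addr0 ?mulr0 //; apply: asc_J.
Qed.

Lemma part20_supportr (k j : 'I_n) X : (k <= j)%N -> part20 br J (w k) X (f j) = 0.
Proof.
move=> kj; rewrite part20_antisym //; last by case: (dual_form10 f_dual k).
by rewrite part20_supportl ?oppr0.
Qed.

Lemma part11_supportl (k i : 'I_n) Y : (k <= i)%N -> part11 br J (w k) (f i) Y = 0.
Proof.
move=> ki; have fi := frame_asc ki.
by rewrite /part11 !dform_asc // mulr0 addr0 mulr0.
Qed.

Lemma part11_supportr (k j : 'I_n) X : (k <= j)%N -> part11 br J (w k) X (f j) = 0.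
Proof.
move=> kj; have fj := frame_asc kj.
have lin : real_linear (w k) by case: (dual_form10 f_dual k).
rewrite /part11 (dform_antisym br_lie _ _ lin) (dform_antisym br_lie _ (J _) lin).
by rewrite !dform_asc ?oppr0 ?mulr0 ?addr0 ?mulr0 //; apply: asc_J.
Qed.

Lemma dform_expand (k : 'I_n) X Y :
  dform br (w k) X Y =
    \sum_(j < n | (j < k)%N) \sum_(i < n | (i < j)%N)
      part20 br J (w k) (f i) (f j) * wedge (w i) (w j) X Y
    + \sum_(i < n | (i < k)%N) \sum_(j < n | (j < k)%N)
      part11 br J (w k) (f i) (f j) * wedge (w i) (conj_form (w j)) X Y.
Proof.
have wk10 := dual_form10 f_dual k; have lin : real_linear (w k) by case: wk10.
pose A i j := part20 br J (w k) (f i) (f j).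
pose B i j := part11 br J (w k) (f i) (f j).
have -> : dform br (w k) X Y = \sum_i \sum_j A i j * (w i X * w j Y)
    + (\sum_i \sum_j B i j * (w i X * (w j Y)^*)
       - \sum_i \sum_j B i j * (w i Y * (w j X)^*)).
  rewrite {1}(dual_expand f_dual X) (real_linear_sum _ _ _ (dform_real_linearl br _ lin)).
  rewrite [X in _ - X]exchange_big -sumrB -big_split; apply: eq_bigr => i _ /=.
  rewrite {1}(dual_expand f_dual Y) (real_linear_sum _ _ _ (dform_real_linearr br _ lin)).
  rewrite -sumrB -big_split; apply: eq_bigr => j _ /=.
  by rewrite dform_cscale // /A /B; ring.
congr (_ + _).
  rewrite (sum_skew (fun i j => w i X * w j Y)); first 1 last.
  - move=> i; have := part20_antisym J br_lie (f i) (f i) lin; rewrite -/(A i i).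
    by move/eqP; rewrite -addr_eq0 -mulr2n mulrn_eq0 => /eqP.
  - by move=> i j; rewrite /A part20_antisym.
  rewrite (@sum_support _ _ k) => [|j kj]; last first.
    by rewrite big1 // => i _; rewrite /A part20_supportr ?mul0r.
  apply: eq_bigr => j _; apply: eq_bigr => i _.
  by rewrite /wedge [w i Y * _]mulrC.
rewrite -sumrB (@sum_support _ _ k) => [|i ki]; last first.
  by rewrite !big1 ?subrr // => j _; rewrite /B part11_supportl ?mul0r.
apply: eq_bigr => i _; rewrite -sumrB (@sum_support _ _ k) => [|j kj]; last first.
  by rewrite /B part11_supportr ?mul0r ?subrr.
by apply: eq_bigr => j _; rewrite -mulrBr.
Qed.

Lemma adapted_structure_equation (k : 'I_n) :
  dform br (w k) =
    \sum_(j < n | (j < k)%N) \sum_(i < n | (i < j)%N)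
      part20 br J (w k) (f i) (f j) *: wedge (w i) (w j)
    + \sum_(i < n | (i < k)%N) \sum_(j < n | (j < k)%N)
      part11 br J (w k) (f i) (f j) *: wedge (w i) (conj_form (w j)).
Proof.
apply/funext => X; apply/funext => Y; rewrite dform_expand !addrfctE !fct_sumE /=.
congr (_ + _); apply: eq_bigr => i _; rewrite !fct_sumE; exact: eq_bigr.
Qed.

(** Otherwise d w_k vanishes as soon as one argument lies in a_(n-m) (dk0 below).
    Then for X in a_(n-m) all brackets [X, Y] are killed by w_0, ..., w_k, hence lie
    in a_(n-k-1), which makes f_m an element of a_(n-m-1), where w_m vanishes. *)
Lemma adapted_coef_neq0 (k m : 'I_n) : k = m.+1 :> nat ->
  [\/ exists2 i : 'I_n, (i < m)%N & part20 br J (w k) (f i) (f m) != 0,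
      exists2 j : 'I_n, (j <= m)%N & part11 br J (w k) (f m) (f j) != 0 |
      exists2 i : 'I_n, (i < m)%N & part11 br J (w k) (f i) (f m) != 0].
Proof.
move=> km; apply: contrapT => all0.
have A0 (i : 'I_n) : (i < m)%N -> part20 br J (w k) (f i) (f m) = 0.
  by move=> im; apply/eqP/negPn/negP => ne0; apply: all0; apply: Or31; exists i.
have B0 (j : 'I_n) : (j <= m)%N -> part11 br J (w k) (f m) (f j) = 0.
  by move=> jm; apply/eqP/negPn/negP => ne0; apply: all0; apply: Or32; exists j.
have B0' (i : 'I_n) : (i < m)%N -> part11 br J (w k) (f i) (f m) = 0.
  by move=> im; apply/eqP/negPn/negP => ne0; apply: all0; apply: Or33; exists i.
have dk0 X Y : a_ (n - m) X -> dform br (w k) X Y = 0.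
  move=> mX; have wX (i : 'I_n) : (i < m)%N -> w i X = 0.
    move=> im; apply: (w_ann i).2; apply: asc_leq mX => //; lia.
  rewrite dform_expand !big1 ?addr0 // => i ik; rewrite big1 // => j jk.
  - rewrite /wedge /conj_form; have [im|mi] := ltnP i m.
      have [->|jm] := eqVneq j m; first by rewrite B0' ?mul0r.
      rewrite (wX j) ?rmorph0; last by move: jm; rewrite -val_eqE /=; lia.
      by rewrite (wX i) // mul0r mulr0 subrr mulr0.
    have -> : i = m by apply: val_inj => /=; lia.
    by rewrite B0 ?mul0r //; lia.
  - have [im|im] := eqVneq i m; first by rewrite im A0 ?mul0r // -im.
    have lt_im : (i < m)%N by move: im; rewrite -val_eqE /=; lia.
    by rewrite /wedge (wX i) // (wX j) ?(ltn_trans jk) // mul0r mulr0 subrr mulr0.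
have fm := frame_asc (leqnn m).
have step X : a_ (n - m) X -> forall Y, a_ (n - k.+1) (br X Y).
  move=> mX Y; apply: adapted_asc => i ik.
  have [->|im] := eqVneq i k.
    by apply/eqP; rewrite -oppr_eq0; apply/eqP; exact: dk0.
  apply: (w_ann i).2; move: mX; rewrite -subnSK // => -[mX _].
  apply: asc_leq (mX Y) => //.
  by have := ltn_ord k; move: im; rewrite -val_eqE /=; lia.
have : a_ (n - k.+1).+1 (f m) by split; apply: step => //; apply: asc_J.
rewrite subnSK // km => /(w_ann m).2 /eqP.
by rewrite (dual_pairing f_dual) eqxx oner_eq0.
Qed.

(** The span in the theorem refers to the coframe, the present one only to the
    flag; this comparison lets the forms w_k be corrected independently. *)
Lemma dspan_lt_sub (k : 'I_n) eta :
  dspan_lt br w k eta -> dspan br J (a_ (n - k)) eta.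
Proof.
move=> [c [c' ->]]; apply: big_ind => [|x y xS yS|j jk].
- exists 0, 0; split; try exact: annihilator10_0.
  apply/funext => X; apply/funext => Y.
  by change (0 = - 0 + (- 0)^* :> R[i]); rewrite oppr0 rmorph0 addr0.
- by rewrite -[x]scale1r -[y]scale1r; apply: dspan_comb.
exists (c j *: w j), ((c' j)^* *: w j).
have wj : annihilator10 J (a_ (n - k)) (w j).
  split=> [|X kX]; first exact: dual_form10 f_dual j.
  by apply: (w_ann j).2; apply: asc_leq kX => //; lia.
split.
- by rewrite -[_ *: _]addr0 -(scale0r (w j)); apply: annihilator10_comb.
- by rewrite -[_ *: _]addr0 -(scale0r (w j)); apply: annihilator10_comb.
by rewrite !dformZ conj_form2Z conjcK dform_conj.
Qed.

End AdaptedCoframe.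

(* The index sets {1, ..., n} are shifted to 'I_n = {0, ..., n-1}; thus m below,
   with k = m + 1, is the index k-1. The coefficients A_{ij}^k and B_{ij}^k are
   A k i j and B k i j. *)
Theorem theorem1p10 (R : realType) (V : vectType R)
    (br : {bilinear V -> V -> V}) (J : 'End(V)) (n : nat)
    (hn : n = dimC V) (hmax : maxN br J) :
  exists (w : 'I_n -> (V -> R[i])) (A B : 'I_n -> 'I_n -> 'I_n -> R[i]),
    [/\ is_coframe J w,
        forall k : 'I_n,
          dform br (w k) =
            \sum_(j < n | (j < k)%N) \sum_(i < n | (i < j)%N)
              A k i j *: wedge (w i) (w j)
            + \sum_(i < n | (i < k)%N) \sum_(j < n | (j < k)%N)
              B k i j *: wedge (w i) (conj_form (w j)),
        forall k m : 'I_n, k = m.+1 :> nat ->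
          [\/ exists2 i : 'I_n, (i < m)%N & A k i m != 0,
              exists2 j : 'I_n, (j <= m)%N & B k m j != 0 |
              exists2 i : 'I_n, (i < m)%N & B k i m != 0]
      & forall k : 'I_n,
          dform br (w k) + dform br (conj_form (w k)) = 0
          \/ (forall a b : R[i],
                dspan_lt br w k
                  (a *: dform br (w k) + b *: dform br (conj_form (w k)))
                <-> a = 0 /\ b = 0)].
Proof.
have [br_lie _ _ J_cplx step] := hmax.
have JJ := complex_structure_sqr J_cplx.
rewrite -hn in step.
have [e flag_e] := flag_basis_exists step.
have dimV : (\dim {:V} < n.*2.+2)%N by rewrite hn /dimC; lia.
have e_free := flag_complex_free J_cplx flag_e.
have [th th_dual] := complex_free_dual JJ dimV e_free.
have th_pairing := dual_pairing th_dual.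
have th_asc (k : 'I_n) X : asc_series br J (n - k.+1) X -> th k X = 0.
  rewrite {1}(dual_expand th_dual X).
  by move=> /(flag_coord0 J_cplx flag_e) -> //; have := ltn_ord k; lia.
have adjusted (k : 'I_n) : exists w : V -> R[i],
    [/\ annihilator10 J (asc_series br J (n - k.+1)) w, w (e k) != 0
      & dform br w + dform br (conj_form w) = 0 \/
        forall a b, dspan br J (asc_series br J (n - k))
          (a *: dform br w + b *: dform br (conj_form w)) -> a = 0 /\ b = 0].
  have [z [be [z0 [be10 be_asc] dich]]] := differential_dichotomy br
    (asc_series br J (n - k)) (dual_form10 th_dual k).
  exists (z *: th k + be); split=> //.
    split=> [|X kX].
      by rewrite -[be]scale1r; apply: form10_comb => //; apply: dual_form10 th_dual k.
    rewrite !addrfctE !scalrfctE th_asc // be_asc ?scaler0 ?addr0 //.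
    by apply: asc_leq kX => //; lia.
  have [ke _] := flag_e k.
  by rewrite !addrfctE !scalrfctE be_asc // th_pairing eqxx addr0 [_ *: _]mulr1.
have [w wP] := choice adjusted.
have w_ann (k : 'I_n) : annihilator10 J (asc_series br J (n - k.+1)) (w k).
  by have [] := wP k.
have w_diag k : w k (e k) != 0 by have [] := wP k.
have [f f_dual] : exists f, dual_frame J w f.
  apply: (triangular_dual_frame JJ th_dual) => // [k|k j kj].
    by case: (w_ann k).
  exact: adapted_triangular flag_e w_ann _ _ kj.
exists w, (fun k i j => part20 br J (w k) (f i) (f j)).
exists (fun k i j => part11 br J (w k) (f i) (f j)).
split.
- exact: dual_frame_coframe f_dual.
- by move=> k; apply: adapted_structure_equation flag_e th_dual w_ann w_diag f_dual k.
- by move=> k m km; apply: adapted_coef_neq0 flag_e th_dual w_ann w_diag f_dual k m km.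
- move=> k; have [_ _ [real0|indep]] := wP k; [by left|right=> a b].
  split=> [ab|[-> ->]]; last first.
    exists 0, 0; rewrite !scale0r addr0 big1 // => j _.
    by rewrite !scale0r addr0.
  exact: indep (dspan_lt_sub w_ann f_dual ab).
Qed.
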